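(* Let $b\geq 0$, $v\geq 1$ be integers. For integers $L,M$ define \[ F_b(L,M,v)=\sum_{j=-\infty}^{\infty}(-1)^jq^{vj^2}{L+M-(v-1)j \brack L-vj}_q{L+b+M+(v-1)j \brack L+b+vj}_q . \] Then for all integers $L,M\geq 0$, \[ \sum_{i=0}^{M}q^{i^2}{2L+b+M-i \brack M-i}_qF_b(L-i,i,v)=\sum_{j=-\infty}^{\infty}(-1)^jq^{(v+1)j^2}{L+M-vj \brack L-(v+1)j}_q{L+b+M+vj \brack L+b+(v+1)j}_q \] and \[ \sum_{i=0}^{M}q^{i^2}{2L+v+M-i \brack M-i}_qF_v(L-i,i,v)=\sum_{j=-\infty}^{\infty}(-1)^jq^{(v+1)j^2}{L+M-vj \brack L-(v+1)j}_q{L+v+1+M+vj \brack L+v+1+(v+1)j}_q , \] where $F_v$ denotes $F_b$ with $b=v$.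
   Context: For integers $n\ge0$, $(q)_n=\prod_{j=1}^{n}(1-q^j)$. For integers $m,n$, ${n+m \brack n}_q=\frac{(q)_{n+m}}{(q)_n(q)_m}$ if $m,n\geq 0$ and $0$ otherwise (so this is defined, possibly zero, for all integer arguments). *)

(* Defs.v *)
From mathcomp Require Export all_boot all_order all_algebra.
From mathcomp Require Export boolp classical_sets functions cardinality fsbigop.
From mathcomp Require Import zify ring.

Set Implicit Arguments.
Unset Strict Implicit.
Unset Printing Implicit Defensive.

Import Order.TTheory GRing.Theory Num.Theory.

Local Open Scope classical_set_scope.
Local Open Scope ring_scope.

Definition qpoch (K : fieldType) (q : K) (n : nat) : K :=
  \prod_(1 <= j < n.+1) (1 - q ^+ j).

(* Top entry N = n + m and bottom entry n, so that m = N - n. *)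
Definition qbinom (K : fieldType) (q : K) (N n : int) : K :=
  if (0 <= n) && (0 <= N - n) then
    qpoch q `|N|%N / (qpoch q `|n|%N * qpoch q `|N - n|%N)
  else 0.

(* The bilateral series are finitely supported sums over int; the finiteness
   of the support, without which such a sum is 0 by convention, is
   finite_support_Fterm below. *)
Definition F (K : fieldType) (q : K) (b L M v : int) : K :=
  \sum_(j \in [set: int])
    (-1) ^ j * q ^ (v * j ^+ 2)
    * qbinom q (L + M - (v - 1) * j) (L - v * j)
    * qbinom q (L + b + M + (v - 1) * j) (L + b + v * j).

Lemma finite_support_Fterm (K : fieldType) (q : K) (b L M v : int) :
  finite_set [set j : int |
    (-1) ^ j * q ^ (v * j ^+ 2)
    * qbinom q (L + M - (v - 1) * j) (L - v * j)
    * qbinom q (L + b + M + (v - 1) * j) (L + b + v * j) != 0].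
Proof.
set S : set int := [set` [seq (i%:Z - M) | i <- iota 0 (absz M).*2.+1]].
apply: (@sub_finite_set _ _ S); last exact: finite_seq.
move=> j /=; rewrite /qbinom.
have -> : L + M - (v - 1) * j - (L - v * j) = M + j by ring.
have -> : L + b + M + (v - 1) * j - (L + b + v * j) = M - j by ring.
case: ifP => [/andP[_ h1]|_]; last by rewrite mulr0 mul0r eqxx.
case: ifP => [/andP[_ h2] _|_]; last by rewrite mulr0 eqxx.
apply/mapP; exists (absz (M + j)); last by lia.
by rewrite mem_iota; lia.
Qed.

(* Main.v *)
(** The first identity holds term by term in [j]: with [A = L - v j] and
    [B = L + b + v j] it is the case (A, B, j, M) of Burge's identity
    [sum_i q^(i^2) [A+B+M-i, M-i] [A+j, A-i] [B-j, B-i]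
       = q^(j^2) [A+M, A-j] [B+M, B+j]],
    a q-Saalschuetz sum that three applications of the q-Vandermonde
    convolution evaluate.

    The second identity follows from the first at [b = v]: by the q-Pascal rule,
    replacing [v] by [v + 1] in the second binomial adds a sum whose summand
    changes sign under [j -> - 1 - j]. Pairing [j] with [- 1 - j] makes it vanish
    in every characteristic, including 2. *)

Require Import Defs.
From mathcomp Require Import zify ring.

Import Order.TTheory GRing.Theory Num.Theory.

Local Open Scope classical_set_scope.
Local Open Scope ring_scope.

(** * Discarding vanishing terms at the ends of finite sums *)

Lemma sum_ord_trunc (V : nmodType) (m n : nat) (f : nat -> V) :
  (m <= n)%N -> (forall k, (m <= k < n)%N -> f k = 0) ->
  \sum_(k < n) f k = \sum_(k < m) f k.
Proof.
move=> mn f0; rewrite -!(big_mkord xpredT f) (big_cat_nat (n := m)) //=.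
by rewrite [X in _ + X]big_nat_cond [X in _ + X]big1 ?addr0 // => k /andP[/f0].
Qed.

Lemma sum_nat_skip (V : nmodType) (k n : nat) (f : nat -> V) :
  (k <= n)%N -> (forall i, (i < k)%N -> f i = 0) ->
  \sum_(0 <= i < n) f i = \sum_(i < n - k) f (i + k)%N.
Proof.
move=> kn f0; rewrite (big_cat_nat (n := k)) //=.
rewrite [X in X + _]big_nat_cond [X in X + _]big1 ?add0r; last first.
  by move=> i /andP[/andP[_ ik] _]; apply: f0.
by rewrite -{1}[k]add0n big_addn big_mkord.
Qed.

(** * Gaussian binomials: symmetry, q-Pascal rule, products of two *)

Section QBinomial.
Variables (K : fieldType) (q : K).
Hypothesis hq : forall k : nat, (0 < k)%N -> q ^+ k <> 1.

Lemma qpoch0 : qpoch q 0 = 1.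
Proof. by rewrite /qpoch big_geq. Qed.

Lemma qpochS (n : nat) : qpoch q n.+1 = qpoch q n * (1 - q ^+ n.+1).
Proof. by rewrite /qpoch big_nat_recr. Qed.

Lemma one_subX_neq0 (n : nat) : 1 - q ^+ n.+1 != 0.
Proof. by rewrite subr_eq0 eq_sym; apply/eqP/hq. Qed.

Lemma qpoch_neq0 (n : nat) : qpoch q n != 0.
Proof.
by elim: n => [|n IH]; rewrite ?qpoch0 ?oner_neq0 // qpochS mulf_neq0 ?one_subX_neq0.
Qed.

Lemma qbinom_eq0 (N n : int) : ~~ ((0 <= n) && (n <= N)) -> qbinom q N n = 0.
Proof. by rewrite -(subr_ge0 n N) /qbinom => /negbTE ->. Qed.

Lemma qbinomC (N n : int) : qbinom q N (N - n) = qbinom q N n.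
Proof.
rewrite /qbinom (_ : N - (N - n) = n); last by ring.
by rewrite andbC [X in _ / X]mulrC.
Qed.

Lemma qbinom_addn (m n : nat) :
  qbinom q (m + n)%:Z n%:Z = qpoch q (m + n) / (qpoch q n * qpoch q m).
Proof.
rewrite /qbinom (_ : (m + n)%:Z - n%:Z = m%:Z); last by lia.
by rewrite !le0z_nat.
Qed.

Lemma qbinom0 (n : nat) : qbinom q n%:Z 0 = 1.
Proof.
by rewrite -[n in n%:Z]addn0 (qbinom_addn n 0) qpoch0 mul1r addn0 divff ?qpoch_neq0.
Qed.

Lemma qbinom_small (n k : nat) : (n < k)%N -> qbinom q n%:Z k%:Z = 0.
Proof. by move=> h; apply: qbinom_eq0; lia. Qed.

Lemma qbinomnn (n : nat) : qbinom q n%:Z n%:Z = 1.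
Proof. by rewrite -qbinomC subrr qbinom0. Qed.

Lemma qbinomS (n k : nat) :
  qbinom q n.+1%:Z k.+1%:Z =
  qbinom q n%:Z k%:Z + q ^+ k.+1 * qbinom q n%:Z k.+1%:Z.
Proof.
case: (ltngtP n k) => [h|h|->].
- by rewrite !qbinom_small ?mulr0 ?addr0 //; lia.
- have [m ->] : exists m, n = (m + k.+1)%N by exists (n - k.+1)%N; lia.
  rewrite qbinom_addn (_ : (m + k.+1).+1 = (m.+1 + k.+1)%N) //.
  rewrite qbinom_addn (_ : (m + k.+1)%N = (m.+1 + k)%N); last by lia.
  rewrite qbinom_addn addSn addnS !qpochS.
  have := one_subX_neq0 m; have := one_subX_neq0 k.
  have := qpoch_neq0 m; have := qpoch_neq0 k.
  have := one_subX_neq0 (m + k).+1; rewrite -addnS -addSn exprD.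
  (* With [x = q^(k+1)] and [y = q^(m+1)] the rule amounts to [1 - x y = (1 - x) + x (1 - y)]. *)
  move: (qpoch q m) (qpoch q k) (qpoch q (m + k)) (q ^+ k.+1) (q ^+ m.+1).
  move=> a b c x y _ a0 b0 x0 y0.
  by field; rewrite a0 b0 x0 y0.
- by rewrite !qbinomnn qbinom_small // mulr0 addr0.
Qed.

(* At N = n = -1 the left-hand side is 1 and the right-hand side 0. *)
Lemma qbinomS_int (N n : int) : (N != -1) || (n != -1) ->
  qbinom q (N + 1) (n + 1) = qbinom q N n + q ^ (n + 1) * qbinom q N (n + 1).
Proof.
move=> Nn; case: (lerP 0 n) => n0.
  case: (lerP n N) => nN; last first.
    by rewrite !qbinom_eq0 ?mulr0 ?addr0 //; lia.
  have [a aN] : exists a : nat, N = a%:Z by exists (absz N); lia.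
  have [k kn] : exists k : nat, n = k%:Z by exists (absz n); lia.
  subst N n; rewrite -![_%:Z + 1]PoszD !addn1; exact: qbinomS.
case: (ltrP n (-1)) => n1.
  by rewrite !qbinom_eq0 ?mulr0 ?addr0 //; lia.
(* What remains is [[N+1, 0] = [N, 0]]; since [N] is not [-1], the tops [N] and [N + 1] are both
   negative or both nonnegative. *)
have n1E : n = -1 by lia.
subst n; rewrite addNr expr0z mul1r (qbinom_eq0 N (-1)) ?add0r //.
case: (lerP 0 N) => N0; last by rewrite !qbinom_eq0 //; lia.
have [a aN] : exists a : nat, N = a%:Z by exists (absz N); lia.
by subst N; rewrite -PoszD !qbinom0.
Qed.

Lemma qbinom_mul (a b c : nat) :
  qbinom q (a + b + c)%:Z (b + c)%:Z * qbinom q (b + c)%:Z c%:Z =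
  qpoch q (a + b + c) / (qpoch q a * qpoch q b * qpoch q c).
Proof.
rewrite -addnA !qbinom_addn.
have := qpoch_neq0 a; have := qpoch_neq0 b; have := qpoch_neq0 c.
have := qpoch_neq0 (b + c) => h1 h2 h3 h4.
by field; rewrite h1 h2 h3 h4.
Qed.

(** * The q-Vandermonde convolution and the q-Saalschuetz sum *)

(** Induction on [m], with the q-Pascal rule on both sides. The exponent [m - i] is truncated only
    where [[m, i]] vanishes. *)
Lemma qVandermonde (m n k : nat) :
  qbinom q (m + n)%:Z k%:Z =
  \sum_(i < k.+1) q ^+ ((m - i) * (k - i)) *
    qbinom q m%:Z i%:Z * qbinom q n%:Z (k - i)%:Z.
Proof.
elim: m k => [|m IH] k.
  rewrite big_ord_recl /= mul0n mul1r qbinom0 mul1r subn0 big1 ?addr0 // => i _.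
  by rewrite qbinom_small ?mulr0 ?mul0r.
case: k => [|k].
  by rewrite big_ord1 /= muln0 !qbinom0 !mulr1.
rewrite addSn qbinomS !IH [in RHS]big_ord_recl [X in _ + _ * X]big_ord_recl.
rewrite mulrDr addrCA; congr (_ + _).
  rewrite !qbinom0 !subn0 !mulr1 mulrA -exprD; congr (q ^+ _ * _); lia.
rewrite mulr_sumr -big_split; apply: eq_bigr => i _ /=.
rewrite /bump /= !add1n !subSS qbinomS.
(* The exponents match only for [i < m]; otherwise [[m, i+1] = 0] removes the term. *)
case: (ltnP i m) => him; last first.
  rewrite (qbinom_small m i.+1) ?ltnS // !(mulr0, mul0r, addr0).
  by [].
rewrite mulrDr mulrDl; congr (_ + _).
rewrite !mulrA -!exprD; congr (q ^+ _ * _ * _).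
have := ltn_ord i; nia.
Qed.

(** This is q-Vandermonde read backwards, with [i = t - k]. Terms with [k > t] vanish, so one bound
    [N] serves all [t <= N] once a double sum has been exchanged. *)
Lemma qVandermonde_shift (n t c N : nat) : (t <= N)%N ->
  \sum_(k < N.+1) q ^+ (k * (k + c)) *
    qbinom q n%:Z (k + c)%:Z * qbinom q t%:Z k%:Z
  = qbinom q (n + t)%:Z (t + c)%:Z.
Proof.
move=> tN; rewrite addnC qVandermonde.
rewrite (sum_ord_trunc _ t.+1 (t + c).+1 (fun i => q ^+ ((t - i) * (t + c - i)) *
  qbinom q t%:Z i%:Z * qbinom q n%:Z (t + c - i)%:Z)); first last.
- by move=> k /andP[tk _]; rewrite qbinom_small // mulr0 mul0r.
- by lia.
rewrite (sum_ord_trunc _ t.+1 N.+1 (fun k => q ^+ (k * (k + c)) *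
  qbinom q n%:Z (k + c)%:Z * qbinom q t%:Z k%:Z)); first last.
- by move=> k /andP[tk _]; rewrite (qbinom_small t) // mulr0.
- by lia.
rewrite (reindex_inj rev_ord_inj); apply: eq_bigr => k _ /=.
have kt : (k <= t)%N by rewrite -ltnS.
rewrite subSS (_ : (t - k)%:Z = t%:Z - k%:Z) ?qbinomC; last by lia.
rewrite (_ : (t - k + c)%N = (t + c - k)%N); last by lia.
by rewrite mulrAC.
Qed.

(** For [c <= n] both sides are the q-multinomial with parts [n - c], [m - t], [t + c]; for [c > n]
    both vanish. *)
Lemma qbinom_mul_swap (n m c t : nat) : (t <= m)%N ->
  qbinom q (n + m)%:Z (m - t)%:Z * qbinom q (n + t)%:Z (t + c)%:Z =
  qbinom q (n + m)%:Z (m + c)%:Z * qbinom q (m + c)%:Z (m - t)%:Z.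
Proof.
move=> tm; case: (leqP c n) => [cn|cn]; last first.
  rewrite (qbinom_small (n + t)) ?(qbinom_small (n + m) (m + c)); try lia.
  by rewrite mulr0 mul0r.
have [a ->] : exists a, n = (a + c)%N by exists (n - c)%N; lia.
have [s ->] : exists s, m = (s + t)%N by exists (m - t)%N; lia.
rewrite addnK -[X in X * _ = _]qbinomC.
rewrite (_ : (a + c + (s + t))%:Z - s%:Z = (a + (t + c))%:Z); last by lia.
rewrite (_ : (a + c + (s + t))%N = (s + a + (t + c))%N); last by lia.
rewrite (_ : (a + c + t)%N = (a + (t + c))%N); last by lia.
rewrite qbinom_mul.
rewrite (_ : (s + a + (t + c))%N = (a + (t + c) + s)%N); last by lia.
rewrite (_ : (s + t + c)%N = (t + c + s)%N); last by lia.
rewrite qbinom_mul; congr (_ / _); ring.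
Qed.

Lemma qbinom_mul_sub (p t k : nat) : (k <= t)%N ->
  qbinom q p%:Z k%:Z * qbinom q (p - k)%:Z (t - k)%:Z =
  qbinom q p%:Z t%:Z * qbinom q t%:Z k%:Z.
Proof.
move=> kt; case: (leqP t p) => [tp|tp]; last first.
  rewrite (qbinom_small p t) // mul0r.
  case: (leqP k p) => kp; first by rewrite (qbinom_small (p - k)) ?mulr0 //; lia.
  by rewrite qbinom_small ?mul0r.
have [a ->] : exists a, p = (a + t)%N by exists (p - t)%N; lia.
have [s ->] : exists s, t = (s + k)%N by exists (t - k)%N; lia.
rewrite addnK -[X in X * _ = _]qbinomC addnA qbinom_mul.
rewrite (_ : (a + s + k)%:Z - k%:Z = (a + s)%:Z); last by lia.
rewrite (_ : (a + s + k - k)%N = (a + s)%N) ?addnK //.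
rewrite (_ : (a + s + k)%N = (k + a + s)%N); last by lia.
rewrite qbinom_mul; congr (_ / _); ring.
Qed.

(** Expand the last factor by q-Vandermonde, splitting its top as [(p - k) + (n + m)], and exchange
    the sums. The sum over [k] is then [qVandermonde_shift], trinomial revision frees [[n+m, m+c]]
    from [t], and the sum over [t] is a third q-Vandermonde. *)
Lemma qSaalschutz (n p m c : nat) :
  \sum_(k < m.+1) q ^+ (k * (k + c)) * qbinom q n%:Z (k + c)%:Z *
    qbinom q p%:Z k%:Z * qbinom q (n + p + m - k)%:Z (m - k)%:Z
  = qbinom q (n + m)%:Z (m + c)%:Z * qbinom q (p + m + c)%:Z m%:Z.
Proof.
have expand (k : 'I_m.+1) :
    qbinom q p%:Z k%:Z * qbinom q (n + p + m - k)%:Z (m - k)%:Z =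
    \sum_(t < m.+1) q ^+ ((p - t) * (m - t)) * qbinom q p%:Z t%:Z *
      qbinom q t%:Z k%:Z * qbinom q (n + m)%:Z (m - t)%:Z.
  have km : (k <= m)%N by rewrite -ltnS.
  case: (leqP k p) => kp; last first.
    rewrite qbinom_small // mul0r big1 // => t _.
    case: (leqP k t) => kt; last by rewrite (qbinom_small t) // mulr0 mul0r.
    by rewrite (qbinom_small p t) ?mulr0 ?mul0r //; lia.
  rewrite (_ : (n + p + m - k)%N = (p - k + (n + m))%N); last by lia.
  (* Setting [t = s + k] and padding with the zero terms [t < k] makes the range independent of [k],
     ready for the exchange. *)
  rewrite qVandermonde -(big_mkord xpredT (fun t => q ^+ ((p - t) * (m - t)) *
    qbinom q p%:Z t%:Z * qbinom q t%:Z k%:Z * qbinom q (n + m)%:Z (m - t)%:Z)).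
  rewrite (sum_nat_skip _ k); first last.
  - by move=> t tk; rewrite (qbinom_small t) // mulr0 mul0r.
  - by lia.
  rewrite subSn // mulr_sumr.
  apply: eq_bigr => s _.
  rewrite -[X in X * _ = _](mulr1 _) -!mulrA mul1r.
  have := qbinom_mul_sub p (s + k) k (leq_addl _ _); rewrite addnK => E.
  rewrite [in RHS](mulrA (qbinom q p%:Z _)) -E.
  rewrite (_ : (p - (s + k))%N = (p - k - s)%N); last by lia.
  rewrite (_ : (m - (s + k))%N = (m - k - s)%N); last by lia.
  ring.
under eq_bigr => k _ do rewrite -mulrA expand mulr_sumr.
rewrite exchange_big /=.
transitivity (\sum_(t < m.+1) qbinom q (n + m)%:Z (m + c)%:Z *
   (q ^+ ((p - t) * (m - t)) * qbinom q p%:Z t%:Z * qbinom q (m + c)%:Z (m - t)%:Z)).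
  apply: eq_bigr => t _; have tm : (t <= m)%N by rewrite -ltnS.
  transitivity (q ^+ ((p - t) * (m - t)) * qbinom q p%:Z t%:Z *
    (qbinom q (n + m)%:Z (m - t)%:Z * qbinom q (n + t)%:Z (t + c)%:Z)).
    rewrite -(qVandermonde_shift n t c m tm) !mulr_sumr.
    by apply: eq_bigr => k _; ring.
  by rewrite qbinom_mul_swap //; ring.
by rewrite -mulr_sumr -qVandermonde addnA.
Qed.

(** * Burge's identity *)

Lemma burge_nonneg (A B : int) (j M : nat) : j%:Z <= B ->
  \sum_(0 <= i < M.+1) q ^+ (i ^ 2) * qbinom q (A + B + M%:Z - i%:Z) (M%:Z - i%:Z) *
    (qbinom q (A + j%:Z) (A - i%:Z) * qbinom q (B - j%:Z) (B - i%:Z))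
  = q ^+ (j ^ 2) * (qbinom q (A + M%:Z) (A - j%:Z) * qbinom q (B + M%:Z) (B + j%:Z)).
Proof.
move=> jB; case: (leqP j M) => jM; last first.
  rewrite [X in _ * (_ * X)]qbinom_eq0; last by lia.
  rewrite !mulr0 big_nat big1 // => i /andP[_ iM].
  by rewrite [X in _ * (_ * X)]qbinom_eq0 ?mulr0 //; lia.
case: (lerP j%:Z A) => jA; last first.
  rewrite [X in _ = _ * (X * _)]qbinom_eq0; last by lia.
  rewrite mul0r !mulr0 big1 // => i _.
  case: (leqP j i) => ji.
    by rewrite [X in _ * (X * _)]qbinom_eq0 ?mul0r ?mulr0 //; lia.
  by rewrite [X in _ * (_ * X)]qbinom_eq0 ?mulr0 //; lia.
(* With [i = k + j] this becomes [qSaalschutz n p m (2j)] up to complementing bottom entries: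
   [(k+j)^2 = j^2 + k(k+2j)], and the terms [i < j] vanish. *)
have [p Bp] : exists p : nat, B = p%:Z + j%:Z by exists (absz (B - j%:Z)); lia.
have [n An] : exists n : nat, A = n%:Z - j%:Z by exists (absz (A + j%:Z)); lia.
have [m Mm] : exists m : nat, M = (m + j)%N by exists (M - j)%N; lia.
subst A B M; rewrite (sum_nat_skip _ j); first last.
- by move=> i ij; rewrite [X in _ * (_ * X)]qbinom_eq0 ?mulr0 //; lia.
- by lia.
rewrite subSn ?leq_addl // addnK.
have := qSaalschutz n p m (j + j).
rewrite -[X in _ = X * _ -> _]qbinomC -[X in _ = _ * X -> _]qbinomC.
rewrite (_ : (n + m)%:Z - (m + (j + j))%:Z = n%:Z - j%:Z - j%:Z); last by lia.
rewrite (_ : (n + m)%:Z = n%:Z - j%:Z + (m + j)%:Z); last by lia.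
rewrite (_ : (p + m + (j + j))%:Z - m%:Z = p%:Z + j%:Z + j%:Z); last by lia.
rewrite (_ : (p + m + (j + j))%:Z = p%:Z + j%:Z + (m + j)%:Z); last by lia.
move=> <-; rewrite mulr_sumr; apply: eq_bigr => k _.
have km : (k <= m)%N by rewrite -ltnS.
rewrite -[X in _ = _ * (_ * X * _ * _)]qbinomC -[X in _ = _ * (_ * X * _)]qbinomC.
have -> : n%:Z - j%:Z + (p%:Z + j%:Z) + (m + j)%:Z - (k + j)%:Z = (n + p + m - k)%:Z by lia.
have -> : (m + j)%:Z - (k + j)%:Z = (m - k)%:Z by lia.
have -> : n%:Z - j%:Z + j%:Z = n%:Z by lia.
have -> : p%:Z + j%:Z - j%:Z = p%:Z by lia.
have -> : n%:Z - j%:Z - (k + j)%:Z = n%:Z - (k + (j + j))%:Z by lia.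
have -> : p%:Z + j%:Z - (k + j)%:Z = p%:Z - k%:Z by lia.
have -> : ((k + j) ^ 2 = j ^ 2 + k * (k + (j + j)))%N by ring.
rewrite exprD; ring.
Qed.

(* The right-hand side is nonzero for some j > B, where every term on the left
   vanishes; hence the two hypotheses. *)
Lemma burge (A B j : int) (M : nat) :
  (0 <= j -> j <= B) -> (j <= 0 -> - j <= A) ->
  \sum_(0 <= i < M.+1) q ^+ (i ^ 2) * qbinom q (A + B + M%:Z - i%:Z) (M%:Z - i%:Z) *
    (qbinom q (A + j) (A - i%:Z) * qbinom q (B - j) (B - i%:Z))
  = q ^ (j ^+ 2) * (qbinom q (A + M%:Z) (A - j) * qbinom q (B + M%:Z) (B + j)).
Proof.
move=> jB jA; case: (lerP 0 j) => j0.
  have [n jn] : exists n : nat, j = n%:Z by exists (absz j); lia.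
  by subst j; rewrite burge_nonneg //; apply: jB.
(* The identity is invariant under exchanging [A] with [B] and [j] with [-j]. *)
have [n jn] : exists n : nat, j = - n%:Z by exists (absz j); lia.
have nA : n%:Z <= A by lia.
subst j; rewrite opprK sqrrN.
have E := burge_nonneg B A n M nA.
rewrite [X in _ = _ * X]mulrC in E.
rewrite -[q ^ _]/(q ^+ (n ^ 2)) -E.
by apply: eq_bigr => i _; rewrite (addrC B A) [X in _ = _ * X]mulrC.
Qed.

End QBinomial.

(** * Bilateral sums as finite sums *)

(** The grouping follows the reflection [j -> -1 - j], so that an antisymmetric summand cancels
    inside each pair. The extra index [-N - 1] contributes zero. *)
Lemma fsum_int (V : nmodType) (N : nat) (f : int -> V) :
  (forall j, ~~ (- N%:Z <= j <= N%:Z) -> f j = 0) ->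
  \sum_(j \in [set: int]) f j = \sum_(t < N.+1) (f t%:Z + f (- 1 - t%:Z)).
Proof.
move=> f0; rewrite big_split /=.
rewrite -(big_mkord xpredT (fun t : nat => f t)).
rewrite -(big_mkord xpredT (fun t : nat => f (- 1 - t%:Z))).
rewrite -(big_map Posz xpredT f) -(big_map (fun t : nat => - 1 - t%:Z) xpredT f).
rewrite -big_cat [RHS]fsbig_seq; last first.
  rewrite cat_uniq !map_inj_uniq ?iota_uniq ?andbT; try by move=> x y; lia.
  by apply/hasPn => _ /mapP[t _ ->]; apply/mapP => -[s _]; lia.
apply/esym/fsbig_widen => // j [_ jN] /=; apply: f0.
apply/negP => jN'; apply: jN; rewrite /mkset mem_cat; apply/orP.
case: (lerP 0 j) => j0; [left|right].
  by apply/mapP; exists (absz j); rewrite ?mem_index_iota; lia.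
by apply/mapP; exists (absz (j + 1)); rewrite ?mem_index_iota; lia.
Qed.

Lemma signz_reflect (R : unitRingType) (j : int) :
  (-1 : R) ^ (- 1 - j) = - (-1) ^ j.
Proof. by rewrite exprzDr ?unitrN1 // exprN1 invrN1 mulN1r -exprz_inv invrN1. Qed.

(** * Raising [v] to [v + 1], and the shift of [b] at [b = v] *)

Section Transform.
Variables (K : fieldType) (q : K).
Hypothesis hq : forall k : nat, (0 < k)%N -> q ^+ k <> 1.
Variable v : int.
Hypothesis hv : 1 <= v.

Definition Fterm (b L M v j : int) : K :=
  (-1) ^ j * q ^ (v * j ^+ 2)
  * qbinom q (L + M - (v - 1) * j) (L - v * j)
  * qbinom q (L + b + M + (v - 1) * j) (L + b + v * j).

Lemma F_Fterm (c L M w : int) : F q c L M w = \sum_(j \in [set: int]) Fterm c L M w j.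
Proof. by []. Qed.

(** Top minus bottom is [i + j] in one factor and [i - j] in the other. The bound by [M] is uniform
    in [i], so the sums over [i] and [j] can be exchanged. *)
Lemma Fterm_support (c L w : int) (i M : nat) (j : int) : (i <= M)%N ->
  ~~ (- M%:Z <= j <= M%:Z) -> Fterm c L i%:Z w j = 0.
Proof.
move=> iM; rewrite negb_and -!ltNge /Fterm => /orP[h|h].
  by rewrite [X in _ * X * _]qbinom_eq0 ?mulr0 ?mul0r //; lia.
by rewrite [X in _ * X]qbinom_eq0 ?mulr0 //; lia.
Qed.

Lemma Fterm_transform (b : int) (L M : nat) (j : int) : 0 <= b ->
  \sum_(0 <= i < M.+1)
      q ^+ (i ^ 2) * qbinom q (2 * L%:Z + b + M%:Z - i%:Z) (M%:Z - i%:Z)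
      * Fterm b (L%:Z - i%:Z) i%:Z v j
  = Fterm b L%:Z M%:Z (v + 1) j.
Proof.
move=> hb; have := burge K q hq (L%:Z - v * j) (L%:Z + b + v * j) j M.
(* Both conditions of [burge] follow from [v >= 1] and [L, b >= 0]. *)
move=> /(_ ltac:(nia) ltac:(nia)) E.
rewrite /Fterm (_ : (v + 1) * j ^+ 2 = v * j ^+ 2 + j ^+ 2); last by ring.
(* As [q = 0] is allowed, exponents are split only when they have the same sign. *)
rewrite exprzD_ss; last by nia.
rewrite (_ : L%:Z + M%:Z - (v + 1 - 1) * j = L%:Z - v * j + M%:Z); last by ring.
rewrite (_ : L%:Z - (v + 1) * j = L%:Z - v * j - j); last by ring.
rewrite (_ : L%:Z + b + M%:Z + (v + 1 - 1) * j = L%:Z + b + v * j + M%:Z); last by ring.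
rewrite (_ : L%:Z + b + (v + 1) * j = L%:Z + b + v * j + j); last by ring.
transitivity ((-1) ^ j * q ^ (v * j ^+ 2) * (q ^ (j ^+ 2) *
  (qbinom q (L%:Z - v * j + M%:Z) (L%:Z - v * j - j) *
   qbinom q (L%:Z + b + v * j + M%:Z) (L%:Z + b + v * j + j)))); last by ring.
rewrite -E mulr_sumr; apply: eq_bigr => i _.
rewrite (_ : L%:Z - v * j + (L%:Z + b + v * j) = 2 * L%:Z + b); last by ring.
rewrite (_ : L%:Z - v * j + j = L%:Z - i%:Z + i%:Z - (v - 1) * j); last by ring.
rewrite (_ : L%:Z - v * j - i%:Z = L%:Z - i%:Z - v * j); last by ring.
rewrite (_ : L%:Z + b + v * j - j = L%:Z - i%:Z + b + i%:Z + (v - 1) * j); last by ring.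
rewrite (_ : L%:Z + b + v * j - i%:Z = L%:Z - i%:Z + b + v * j); last by ring.
ring.
Qed.

Lemma F_transform (b : int) (L M : nat) : 0 <= b ->
  \sum_(0 <= i < M.+1)
      q ^+ (i ^ 2) * qbinom q (2 * L%:Z + b + M%:Z - i%:Z) (M%:Z - i%:Z)
      * F q b (L%:Z - i%:Z) i%:Z v
  = F q b L%:Z M%:Z (v + 1).
Proof.
move=> hb; rewrite F_Fterm (fsum_int _ M); last by move=> j; apply: Fterm_support.
under [RHS]eq_bigr => t _ do rewrite -!Fterm_transform // -big_split /=.
rewrite exchange_big /=; apply: eq_big_nat => i /andP[_ iM].
rewrite F_Fterm (fsum_int _ M); last by move=> j; apply: Fterm_support.
by rewrite mulr_sumr; apply: eq_bigr => t _; rewrite mulrDr.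
Qed.

Lemma F_shift (L M : nat) : F q (v + 1) L%:Z M%:Z (v + 1) = F q v L%:Z M%:Z (v + 1).
Proof.
(* [G] is the extra term of the q-Pascal rule, its exponent regrouped so that only the
   reflection-invariant [j^2 + j + 1] involves [j]. *)
pose G (j : int) := (-1) ^ j * q ^ ((v + 1) * (j ^+ 2 + j + 1) + L%:Z) *
  (qbinom q (L%:Z + M%:Z - v * j) (L%:Z - (v + 1) * j) *
   qbinom q (L%:Z + M%:Z + v * (j + 1)) (L%:Z + (v + 1) * (j + 1))).
have FG j : Fterm (v + 1) L M (v + 1) j = Fterm v L M (v + 1) j + G j.
  case: (boolP (- M%:Z <= j <= M%:Z)) => jM; last first.
    rewrite !(@Fterm_support _ _ _ M M) // add0r /G.
    move: jM; rewrite negb_and -!ltNge => /orP[h|h].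
      by rewrite [X in _ * (X * _)]qbinom_eq0 ?mul0r ?mulr0 //; lia.
    by rewrite [X in _ * (_ * X)]qbinom_eq0 ?mulr0 //; lia.
  rewrite /Fterm.
  have -> : L%:Z + (v + 1) + M%:Z + (v + 1 - 1) * j =
            L%:Z + v + M%:Z + (v + 1 - 1) * j + 1 by ring.
  have -> : L%:Z + (v + 1) + (v + 1) * j = L%:Z + v + (v + 1) * j + 1 by ring.
  (* Top minus bottom is [M - j], so both could be [-1] only at [j = M], where the bottom is
     positive. *)
  rewrite qbinomS_int //; last by nia.
  rewrite mulrDr; congr (_ + _); rewrite /G.
  have -> : v + 1 - 1 = v by ring.
  have -> : L%:Z + v + M%:Z + v * j = L%:Z + M%:Z + v * (j + 1) by ring.
  have -> : L%:Z + v + (v + 1) * j + 1 = L%:Z + (v + 1) * (j + 1) by ring.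
  (* A negative bottom entry makes the q-binomial zero; otherwise the powers of [q] combine even at
     [q = 0]. *)
  case: (lerP 0 (L%:Z + (v + 1) * (j + 1))) => h; last first.
    by rewrite (qbinom_eq0 _ _ _ (L%:Z + (v + 1) * (j + 1))) ?mulr0 //; lia.
  have -> : (v + 1) * (j ^+ 2 + j + 1) + L%:Z =
    (v + 1) * j ^+ 2 + (L%:Z + (v + 1) * (j + 1)) by ring.
  rewrite [X in _ = _ * X * _]exprzD_ss; last by rewrite h mulr_ge0 ?sqr_ge0 //; lia.
  ring.
(* The reflection exchanges the two q-binomials and flips the sign. *)
have G_antisym j : G (- 1 - j) = - G j.
  rewrite /G signz_reflect.
  have -> : (- 1 - j) ^+ 2 + (- 1 - j) + 1 = j ^+ 2 + j + 1 by ring.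
  have -> : - 1 - j + 1 = - j by ring.
  have -> : L%:Z + M%:Z - v * (- 1 - j) = L%:Z + M%:Z + v * (j + 1) by ring.
  have -> : L%:Z - (v + 1) * (- 1 - j) = L%:Z + (v + 1) * (j + 1) by ring.
  rewrite !mulrN; ring.
rewrite !F_Fterm !(fsum_int _ M); try by move=> j; apply: Fterm_support.
apply: eq_bigr => t _; rewrite !FG G_antisym; ring.
Qed.

End Transform.

Theorem theorem5p3 (K : fieldType) (q : K)
    (hq : forall k : nat, (0 < k)%N -> q ^+ k <> 1)
    (b v : int) (hb : 0 <= b) (hv : 1 <= v) (L M : nat) :
  \sum_(0 <= i < M.+1)
      q ^+ (i ^ 2) * qbinom q (2 * L%:Z + b + M%:Z - i%:Z) (M%:Z - i%:Z)
      * F q b (L%:Z - i%:Z) i%:Z v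
  = \sum_(j \in [set: int])
      (-1) ^ j * q ^ ((v + 1) * j ^+ 2)
      * qbinom q (L%:Z + M%:Z - v * j) (L%:Z - (v + 1) * j)
      * qbinom q (L%:Z + b + M%:Z + v * j) (L%:Z + b + (v + 1) * j)
  /\
  \sum_(0 <= i < M.+1)
      q ^+ (i ^ 2) * qbinom q (2 * L%:Z + v + M%:Z - i%:Z) (M%:Z - i%:Z)
      * F q v (L%:Z - i%:Z) i%:Z v
  = \sum_(j \in [set: int])
      (-1) ^ j * q ^ ((v + 1) * j ^+ 2)
      * qbinom q (L%:Z + M%:Z - v * j) (L%:Z - (v + 1) * j)
      * qbinom q (L%:Z + v + 1 + M%:Z + v * j) (L%:Z + v + 1 + (v + 1) * j).
Proof.
split.
  rewrite F_transform // /F; apply: eq_fsbigr => j _.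
  by rewrite addrK.
rewrite F_transform //; last exact: le_trans hv.
rewrite -F_shift // /F; apply: eq_fsbigr => j _.
by rewrite addrK !(addrA L%:Z).
Qed.
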